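(* Let $t \ge q > i \ge 1$ be integers and let $\mathcal{H}$ be a $q$-uniform hypergraph on $n$ vertices. For each $I \in \binom{V(\mathcal{H})}{i}$ define the real number $x(I) \ge q-i-1$ by $d(I) = \binom{x(I)-i}{q-i}$, and for each $T \in \mathcal{K}_t(\mathcal{H})$ define \[ x(T) = \max\Big\{x(I) : I \in \binom{T}{i}\Big\} \quad\text{and}\quad s(T) = \frac{1}{\binom{x(T)-i}{t-i}}. \] Then $s(T)$ is well-defined and decreasing as a function of $x(T)$, \[ \sum_{T \in \mathcal{K}_t(\mathcal{H})} s(T) \le \frac{\binom{n}{i}}{\binom{t}{i}}, \] and there is an infinite family of hypergraphs that achieve this bound.
   Context: A hypergraph is $q$-uniform if every edge is a set of $q$ vertices. For a set $I$ of vertices, $d(I)$ is the number of edges containing $I$. $K^{(q)}_t$ is the complete $q$-uniform hypergraph on $t$ vertices, and $\mathcal{K}_t(\mathcal{H}) = \{S \subseteq V(\mathcal{H}) : \mathcal{H}[S] \cong K^{(q)}_t\}$. Generalized binomial coefficients: for real $x \ge k-1$ and natural $k$, $\binom{x}{k} = x(x-1)\cdots(x-k+1)/k!$, and $\binom{x}{k} = 0$ when $x < k-1$. *)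

(* Defs.v *)
From HB Require Import structures.
From mathcomp Require Import all_boot all_order all_algebra.
From mathcomp Require Import boolp reals.

Set Implicit Arguments.
Unset Strict Implicit.
Unset Printing Implicit Defensive.

Import Order.TTheory GRing.Theory Num.Theory.
Local Open Scope ring_scope.

(* A hypergraph with vertex type V is given by its edge set H : {set {set V}};
   its number of vertices is #|V|. *)

Definition uniform (q : nat) (V : finType) (H : {set {set V}}) : Prop :=
  forall e, e \in H -> #|e| = q.

Definition degree (V : finType) (H : {set {set V}}) (I : {set V}) : nat :=
  #|[set e in H | I \subset e]|.

Definition complete_hypergraph (q t : nat) : {set {set 'I_t}} :=
  [set e : {set 'I_t} | #|e| == q].

Definition induced (V : finType) (H : {set {set V}}) (S : {set V}) :
    {set {set {x : V | x \in S}}} :=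
  [set e : {set {x : V | x \in S}} | [set val x | x in e] \in H].

Definition hypergraph_iso (V W : finType)
    (H : {set {set V}}) (G : {set {set W}}) : Prop :=
  exists2 f : V -> W, bijective f &
    forall e : {set V}, (f @: e \in G) = (e \in H).

Definition cliques (q t : nat) (V : finType) (H : {set {set V}}) :
    {set {set V}} :=
  [set S : {set V} |
     `[< hypergraph_iso (induced H S) (complete_hypergraph q t) >]].

Definition gbinom (R : realType) (x : R) (k : nat) : R :=
  if x < k%:R - 1 then 0 else (\prod_(j < k) (x - j%:R)) / k`!%:R.

(* The two conditions determine x I uniquely only if degree H I > 0: when
   degree H I = 0, any value between q - i - 1 and q - 1 is allowed. The values
   of x on sets of size other than i are irrelevant. *)
Definition degree_param (R : realType) (q i : nat) (V : finType)
    (H : {set {set V}}) (x : {set V} -> R) : Prop :=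
  forall I : {set V}, #|I| = i ->
    q%:R - i%:R - 1 <= x I /\
    (degree H I)%:R = gbinom (x I - i%:R) (q - i).

(* The default value 0 is harmless: T has i-subsets when i <= #|T|, and
   q - i - 1 >= 0 bounds their x-values below when i < q. *)
Definition xmax (R : realType) (i : nat) (V : finType)
    (x : {set V} -> R) (T : {set V}) : R :=
  \big[Num.max/0]_(I : {set V} | (I \subset T) && (#|I| == i)) x I.

(* s(T) is weight t i (xmax i x T). *)
Definition weight (R : realType) (t i : nat) (y : R) : R :=
  1 / gbinom (y - i%:R) (t - i).

(* Main.v *)
(* Every t-clique T contains 'C(t, i) sets I of size i, and s(T) is at most the
   weight computed from x(I) alone, so it suffices that each I contributes at
   most 1, i.e. that at most binom(x(I) - i, t - i) cliques contain I.  This is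
   Lovász's form of the Kruskal-Katona theorem applied to the link of I, proved
   here following Keevash: if G has binom(x, r) edges, then each vertex v of
   degree d lies in at most (x / r - 1) d cliques on r + 1 vertices.  For small d
   this holds by induction in the link of v; for large d it holds because the
   map S |-> S :\ v sends those cliques to edges avoiding v.  Summing over v
   bounds the number of (r + 1)-cliques, and one iterates.  Complete hypergraphs
   give equality. *)
Require Import Defs.
From HB Require Import structures.
From mathcomp Require Import all_boot all_order all_algebra.
From mathcomp Require Import boolp reals.
From mathcomp Require Import ring lra zify.

Set Implicit Arguments.
Unset Strict Implicit.
Unset Printing Implicit Defensive.

Import Order.TTheory GRing.Theory Num.Theory.
Local Open Scope ring_scope.

(** * Real binomial coefficients as polynomials *)

(* The polynomial binomial coefficient, without the cutoff of [gbinom]. *)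
Definition rbinom (R : realType) (x : R) (k : nat) : R :=
  (\prod_(j < k) (x - j%:R)) / k`!%:R.

Lemma gbinomE (R : realType) (x : R) k :
  k%:R - 1 <= x -> gbinom x k = rbinom x k.
Proof. by rewrite /gbinom leNgt => /negbTE ->. Qed.

Lemma rbinom0 (R : realType) (x : R) : rbinom x 0 = 1.
Proof. by rewrite /rbinom big_ord0 divr1. Qed.

Lemma rbinomS (R : realType) (x : R) k :
  rbinom x k.+1 = (x - k%:R) / k.+1%:R * rbinom x k.
Proof.
rewrite /rbinom big_ord_recr factS natrM /=.
have h1 : k`!%:R != 0 :> R by rewrite pnatr_eq0 -lt0n fact_gt0.
have h2 : k.+1%:R != 0 :> R by rewrite pnatr_eq0.
by field; rewrite h1 (_ : 1 + k%:R = k.+1%:R) ?h2 // -natr1 addrC.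
Qed.

Lemma rbinom_absorb (R : realType) (x : R) k :
  rbinom x k.+1 = x / k.+1%:R * rbinom (x - 1) k.
Proof.
elim: k => [|k IH]; first by rewrite rbinomS !rbinom0 subr0.
rewrite rbinomS IH (rbinomS (x - 1)).
have -> : x - k.+1%:R = x - 1 - k%:R by rewrite -natr1; ring.
by move: k.+1%:R^-1 k.+2%:R^-1 (rbinom _ _) => u v w; ring.
Qed.

Lemma rbinom_nat (R : realType) n k : rbinom n%:R k = 'C(n, k)%:R :> R.
Proof.
elim: k n => [|k IH] [|n].
- by rewrite rbinom0 bin0.
- by rewrite rbinom0 bin0.
- by rewrite rbinom_absorb !mul0r bin0n.
have -> : 'C(n.+1, k.+1)%:R = n.+1%:R / k.+1%:R * 'C(n, k)%:R :> R.
  have k1 : k.+1%:R != 0 :> R by rewrite pnatr_eq0.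
  rewrite mulrAC; apply: (mulIf k1).
  by rewrite divfK // -!natrM (mul_bin_diag n.+1) mulnC.
by rewrite rbinom_absorb -IH; congr (_ * rbinom _ _); rewrite -natr1 addrK.
Qed.

Lemma rbinom_gt0 (R : realType) (x : R) k : k%:R - 1 < x -> 0 < rbinom x k.
Proof.
move=> hx; rewrite divr_gt0 ?ltr0n ?fact_gt0 // prodr_gt0 // => j _.
have : j.+1%:R <= k%:R :> R by rewrite ler_nat.
by rewrite -natr1; lra.
Qed.

Lemma rbinom_ge0 (R : realType) (x : R) k : k%:R - 1 <= x -> 0 <= rbinom x k.
Proof.
move=> hx; rewrite divr_ge0 ?ler0n // prodr_ge0 // => j _.
have : j.+1%:R <= k%:R :> R by rewrite ler_nat.
by rewrite -natr1; lra.
Qed.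

(** The largest root is [k]; to its right, both factors given by [rbinomS] are nonnegative and
    strictly increasing. *)
Lemma rbinom_lt (R : realType) (x y : R) k :
  k%:R <= x -> x < y -> rbinom x k.+1 < rbinom y k.+1.
Proof.
elim: k => [|k IH] hx xy.
  by rewrite !rbinomS !rbinom0 !divr1 !mulr1 !subr0.
rewrite !(rbinomS _ k.+1).
have kx : k%:R < x by apply: lt_le_trans hx; rewrite ltr_nat.
apply: ltr_pM; last exact: IH (ltW kx) xy.
- by rewrite divr_ge0 // subr_ge0.
- by rewrite rbinom_ge0 // -natr1 addrK ltW.
- by rewrite ltr_pM2r ?invr_gt0 ?ltr0n // ltrD2r.
Qed.

Lemma rbinom_le (R : realType) (x y : R) k :
  k%:R <= x -> x <= y -> rbinom x k.+1 <= rbinom y k.+1.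
Proof.
by move=> kx; rewrite le_eqVlt => /predU1P[->//|/(rbinom_lt kx)/ltW].
Qed.

Lemma rbinom_inj (R : realType) (x y : R) k :
  k%:R <= x -> k%:R <= y -> rbinom x k.+1 = rbinom y k.+1 -> x = y.
Proof.
move=> kx ky e; case: (ltgtP x y) => // h.
  by have := rbinom_lt kx h; rewrite e ltxx.
by have := rbinom_lt ky h; rewrite e ltxx.
Qed.

(** Intermediate value theorem for the falling factorial minus [a]. *)
Lemma rbinom_surj (R : realType) k (c : R) :
  0 <= c -> exists2 x, k%:R <= x & rbinom x k.+1 = c.
Proof.
move=> c0; pose a := k.+1`!%:R * c.
have a0 : 0 <= a by rewrite mulr_ge0.
pose p : {poly R} := \prod_(j < k.+1) ('X - j%:R%:P) - a%:P.
have pE y : p.[y] = \prod_(j < k.+1) (y - j%:R) - a.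
  rewrite /p hornerD hornerN hornerC horner_prod; congr (_ - _).
  by apply: eq_bigr => j _; rewrite hornerXsubC.
(* At [k] the last factor vanishes. At [k.+1%:R + a] the factor for [j = 0] is at least [a] and all
   others are at least 1, so the product is at least [a]. *)
have [||x /andP[kx _]] := @poly_ivt R p k%:R (k.+1%:R + a).
- by rewrite -natr1; lra.
- rewrite !pE big_ord_recr /= subrr mulr0 sub0r oppr_le0 a0 /=.
  rewrite subr_ge0 big_ord_recl /= subr0.
  apply: (@le_trans _ _ (k.+1%:R + a)); first by rewrite lerDr.
  rewrite ler_peMr ?addr_ge0 //.
  apply: (big_ind (fun u => 1 <= u)) => // [u v hu hv|j _].
    by rewrite mulr_ege1.
  have : (lift ord0 j).+1%:R <= k.+1%:R :> R by rewrite ler_nat ltn_ord.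
  by rewrite -[(lift _ _).+1%:R]natr1; lra.
rewrite /root pE subr_eq0 => /eqP e; exists x => //.
by rewrite /rbinom e /a mulrC mulKf // pnatr_eq0 -lt0n fact_gt0.
Qed.

(** Together with [leq_card_full], this turns the presence of one clique into an integer lower bound
    on a real parameter. *)
Lemma rbinom_ge_nat (R : realType) (x : R) n k :
  k%:R <= x -> (k <= n)%N -> 'C(n, k.+1)%:R <= rbinom x k.+1 -> n%:R <= x.
Proof.
move=> kx kn; rewrite -(rbinom_nat R) !leNgt; apply: contra => h.
exact: rbinom_lt.
Qed.

(** * Cliques, links and double counting *)

(** Unlike [cliques], this form involves no isomorphism and passes easily to subsets and links;
    [cliquesE] relates the two. *)
Definition full (V : finType) (G : {set {set V}}) (r m : nat) : {set {set V}} :=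
  [set S : {set V} |
     (#|S| == m) && ([set e : {set V} | e \subset S & #|e| == r] \subset G)].

Lemma fullP (V : finType) (G : {set {set V}}) r m (S : {set V}) :
  reflect (#|S| = m /\ forall e : {set V}, e \subset S -> #|e| = r -> e \in G)
          (S \in full G r m).
Proof.
rewrite inE; apply: (iffP andP) => [[/eqP-> /subsetP h]|[-> h]]; split=> //.
  by move=> e eS er; apply: h; rewrite inE eS er /=.
by apply/subsetP => e; rewrite inE => /andP[eS /eqP]; apply: h.
Qed.

Lemma exists_subset_card (V : finType) (S : {set V}) k :
  (k <= #|S|)%N -> exists2 e : {set V}, e \subset S & #|e| = k.
Proof.
move=> kS; have : (0 < #|[set e : {set V} | e \subset S & #|e| == k]|)%N.
  by rewrite cards_draws bin_gt0.
by case/card_gt0P => e; rewrite inE => /andP[eS /eqP ek]; exists e.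
Qed.

Lemma leq_card_full (V : finType) (G : {set {set V}}) r m S :
  S \in full G r m -> ('C(m, r) <= #|G|)%N.
Proof.
rewrite inE => /andP[/eqP <- /subset_leq_card].
by rewrite cards_draws.
Qed.

(** Double counting: after exchanging the sums, each [S] occurs once for each of its [i]-subsets. *)
Lemma sum_subsets (M : nmodType) (V : finType) (K : {set {set V}}) m i
    (w : {set V} -> M) : uniform m K ->
  \sum_(I : {set V} | #|I| == i) \sum_(S in K | I \subset S) w S
    = (\sum_(S in K) w S) *+ 'C(m, i).
Proof.
move=> Km; rewrite (exchange_big_dep (mem K)) //= => [|I S _ /andP[]//].
rewrite -sumrMnl; apply: eq_bigr => S SK; have {}SK : S \in K := SK.
rewrite -(Km S SK) -cards_draws -sumr_const; apply: eq_bigl => I.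
by rewrite inE SK andbC.
Qed.

Definition link (V : finType) (G : {set {set V}}) (I : {set V}) :=
  [set e :\: I | e in [set e in G | I \subset e]].

Lemma setDUK (V : finType) (I e : {set V}) : I \subset e -> (e :\: I) :|: I = e.
Proof. by move=> Ie; rewrite setUC -[in RHS](setID e I) (setIidPr Ie). Qed.

Lemma setUDK (V : finType) (I e : {set V}) : [disjoint e & I] -> (e :|: I) :\: I = e.
Proof. by move=> eI; rewrite setDUl setDv setU0; apply/setDidPl. Qed.

Lemma card_link (V : finType) (G : {set {set V}}) (I : {set V}) :
  #|link G I| = degree G I.
Proof.
apply: card_in_imset => e f; rewrite !inE => /andP[_ Ie] /andP[_ If] h.
by rewrite -(setDUK Ie) h setDUK.
Qed.

Lemma uniform_link (V : finType) (G : {set {set V}}) r (I : {set V}) :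
  uniform r G -> uniform (r - #|I|) (link G I).
Proof.
move=> Gr e /imsetP[f]; rewrite inE => /andP[fG If] ->.
by rewrite cardsDS // Gr.
Qed.

(** Deleting [I] is injective on sets containing [I]. If [e] is a subset of [S :\: I] of size
    [r - #|I|], then [e :|: I] is an [r]-subset of [S], hence an edge. *)
Lemma full_link (V : finType) (G : {set {set V}}) r m (I : {set V}) :
  (#|I| <= r)%N ->
  (#|[set S in full G r m | I \subset S]|
     <= #|full (link G I) (r - #|I|) (m - #|I|)|)%N.
Proof.
move=> Ir; rewrite -(@card_in_imset _ _ (fun S => S :\: I)); last first.
  move=> e f; rewrite !inE => /andP[_ Ie] /andP[_ If] h.
  by rewrite -(setDUK Ie) h setDUK.
apply/subset_leq_card/subsetP => _ /imsetP[S + ->].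
rewrite inE => /andP[/fullP[Sm SG] IS].
apply/fullP; split=> [|e]; first by rewrite cardsDS // Sm.
rewrite subsetD => /andP[eS eI] er.
apply/imsetP; exists (e :|: I); last by rewrite setUDK.
rewrite inE subsetUr andbT; apply: SG; first by rewrite subUset eS.
by rewrite cardsU (disjoint_setI0 eI) cards0 er subn0 subnK.
Qed.

(** The sets [S :\: I] are edges disjoint from [I]. As [I] is nonempty, none of them is among the
    edges containing [I], and both families lie in [G]. *)
Lemma full_avoid (V : finType) (G : {set {set V}}) r m (I : {set V}) :
  (0 < #|I|)%N -> (m - #|I|)%N = r ->
  (#|[set S in full G r m | I \subset S]| + degree G I <= #|G|)%N.
Proof.
move=> I0 mr; rewrite -(@card_in_imset _ _ (fun S => S :\: I)); last first.
  move=> e f; rewrite !inE => /andP[_ Ie] /andP[_ If] h.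
  by rewrite -(setDUK Ie) h setDUK.
set A := imset _ _; set B := [set e in G | I \subset e].
have AB : [disjoint A & B].
  apply/pred0P => e /=; apply/negP => /andP[/imsetP[S _ ->]].
  rewrite inE subsetD -setI_eq0 setIid -cards_eq0 eqn0Ngt I0.
  by rewrite !andbF.
rewrite /degree -/B -cardsUI (disjoint_setI0 AB) cards0 addn0.
apply/subset_leq_card; rewrite subUset; apply/andP; split; last first.
  by apply/subsetP => e; rewrite inE => /andP[].
apply/subsetP => _ /imsetP[S + ->]; rewrite inE => /andP[/fullP[Sm SG] IS].
by apply: SG; rewrite ?subsetDl // cardsDS // Sm.
Qed.

(** The handshake identity, with vertices represented by singletons so that [degree] and [link]
    apply to them. *)
Lemma sum_card1 (R : pzSemiRingType) (V : finType) (K : {set {set V}}) m :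
  uniform m K ->
  \sum_(I : {set V} | #|I| == 1%N) #|[set S in K | I \subset S]|%:R
    = m%:R * #|K|%:R :> R.
Proof.
move=> Km; rewrite -[m in RHS]bin1 mulr_natl -sumr_const -(sum_subsets _ _ Km).
by apply: eq_bigr => I _; rewrite -sum1dep_card natr_sum.
Qed.

(** * Lovász's form of the Kruskal-Katona theorem *)

(** Summed over the vertices, the local bounds give [r.+2] times the clique count on the left and
    [(x - r.+1%:R) * #|G|%:R] on the right; [rbinomS] then concludes. *)
Lemma card_full_local (R : realType) (V : finType) r (G : {set {set V}}) (x : R) :
  uniform r.+1 G -> #|G|%:R = rbinom x r.+1 ->
  (forall I : {set V}, #|I| = 1%N ->
     #|[set S in full G r.+1 r.+2 | I \subset S]|%:R
       <= (x - r.+1%:R) / r.+1%:R * (degree G I)%:R) ->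
  #|full G r.+1 r.+2|%:R <= rbinom x r.+2.
Proof.
move=> Gr Gx key.
have Kr : uniform r.+2 (full G r.+1 r.+2) by move=> S /fullP[].
have r1 : r.+1%:R != 0 :> R by rewrite pnatr_eq0.
rewrite -(ler_pM2l (_ : 0 < r.+2%:R)) ?ltr0n // -(sum_card1 R Kr).
rewrite rbinomS -Gx mulrA mulrCA divff ?pnatr_eq0 // mulr1.
apply: le_trans (ler_sum _ (fun I hI => key I (eqP hI))) _.
by rewrite -mulr_sumr (sum_card1 R Gr) mulrA divfK.
Qed.

(** The case of large degree [d]: by [full_avoid] the cliques through [I] number at most [#|G| - d],
    and absorption with the lower bound on [d] gives [#|G| <= x / (r + 1) * d]. *)
Lemma card_full_codegree (R : realType) (V : finType) r (G : {set {set V}})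
    (x : R) (I : {set V}) :
  0 <= x -> #|I| = 1%N -> #|G|%:R = rbinom x r.+1 ->
  rbinom (x - 1) r <= (degree G I)%:R ->
  #|[set S in full G r.+1 r.+2 | I \subset S]|%:R
    <= (x - r.+1%:R) / r.+1%:R * (degree G I)%:R.
Proof.
move=> x0 I1 Gx hd.
have := @full_avoid _ G r.+1 r.+2 I; rewrite I1 subn1 => /(_ isT erefl).
rewrite -(ler_nat R) natrD Gx rbinom_absorb => hK.
rewrite mulrBl divff ?pnatr_eq0 // mulrBl mul1r lerBrDr.
apply: le_trans hK _; apply: ler_wpM2l hd.
by rewrite divr_ge0.
Qed.

Lemma card_full_next (R : realType) (V : finType) r (G : {set {set V}}) (x : R) :
  uniform r.+1 G -> r.+1%:R <= x -> #|G|%:R = rbinom x r.+1 ->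
  #|full G r.+1 r.+2|%:R <= rbinom x r.+2.
Proof.
elim: r G x => [|r IH] G x Gr rx Gx; apply: card_full_local => // I I1.
all: have x0 : 0 <= x by apply: le_trans rx.
  (* In the 1-uniform case the threshold [rbinom (x - 1) 0] is 1, so a positive degree is already
     large; a vertex of degree 0 lies in no clique. *)
  have [d0|d0] := posnP (degree G I).
    have := full_link G 2 (_ : #|I| <= 1)%N; rewrite I1 !subnn => /(_ isT).
    have [->|[S SK]] := set_0Vmem (full (link G I) 0 (2 - 1)).
      by rewrite cards0 leqn0 => /eqP->; rewrite d0 mulr0.
    by have := leq_card_full SK; rewrite card_link d0 bin0.
  by apply: card_full_codegree; rewrite // rbinom0 ler1n.
have r0 : 0 < r.+2%:R :> R by rewrite ltr0n.
have [h|h] := leP (rbinom (x - 1) r.+1) (degree G I)%:R.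
  exact: card_full_codegree.
have Ir : (#|I| <= r.+2)%N by rewrite I1.
have := full_link G r.+3 Ir; rewrite I1 !subn1 /= => hK.
have := @uniform_link _ _ _ I Gr; rewrite I1 subn1 /= => Lr.
have [K0|[S SK]] := set_0Vmem (full (link G I) r.+1 r.+2).
  move: hK; rewrite K0 cards0 leqn0 => /eqP->.
  by rewrite mulr_ge0 // divr_ge0 ?subr_ge0.
have d0 := leq_card_full SK; rewrite card_link in d0.
have [z rz zd] := rbinom_surj r (ler0n R (degree G I)).
(* [rbinom_surj] yields only [r <= z], one short of what the induction hypothesis requires; the
   clique [S] makes the degree at least 1, which closes the gap. *)
have {}rz : r.+1%:R <= z.
  apply: rbinom_ge_nat (leqnSn r) _ => //; rewrite zd ler_nat binn.
  by apply: leq_trans d0; rewrite bin_gt0.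
have zx : z <= x - 1.
  rewrite leNgt; apply/negP => xz; move: h; rewrite -zd ltNge rbinom_le //.
    by move: rx; rewrite -!natr1; lra.
  exact: ltW.
apply: (@le_trans _ _ #|full (link G I) r.+1 r.+2|%:R); first by rewrite ler_nat.
apply: le_trans (IH _ z Lr rz _) _; first by rewrite card_link.
rewrite rbinomS zd ler_wpM2r // ler_pM2r ?invr_gt0 //.
by move: zx; rewrite -!natr1; lra.
Qed.

(* [full r m.+1] consists of (m.+1)-cliques of the m-uniform hypergraph
   [full r m], so the one-step bound can be iterated. *)
Lemma card_full (R : realType) (V : finType) r m (G : {set {set V}}) (x : R) :
  uniform r.+1 G -> r.+1%:R <= x -> #|G|%:R = rbinom x r.+1 -> (r < m)%N ->
  full G r.+1 m != set0 ->
  m%:R <= x /\ #|full G r.+1 m|%:R <= rbinom x m.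
Proof.
move=> Gr rx Gx; elim: m => // m IH; rewrite ltnS leq_eqVlt.
case/predU1P=> [<- _|rm K0].
  split=> //; rewrite -Gx ler_nat; apply/subset_leq_card/subsetP => S /fullP[Sr].
  exact.
have /set0Pn[S SK] := K0.
have sub : full G r.+1 m.+1 \subset full (full G r.+1 m) m m.+1.
  apply/subsetP => T /fullP[Tm TG]; apply/fullP; split=> // e eT em.
  apply/fullP; split=> // f fe; apply: TG; exact: subset_trans fe eT.
have mK := leq_card_full (subsetP sub _ SK).
case: m => // m in IH rm K0 S SK sub mK *.
have [||mx Kx] := IH; first by [].
  by rewrite -card_gt0 (leq_trans _ mK) // bin_gt0.
(* The parameter [x] only bounds this count from above, whereas [card_full_next] needs it exactly,
   hence a new [z]. The clique [S] forces [m.+2 <= z], and [z <= x] then carries both conclusions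
   back to [x]. *)
have [z mz zK] := rbinom_surj m (ler0n R #|full G r.+1 m.+1|).
have {}mz : m.+2%:R <= z.
  by apply: (rbinom_ge_nat mz); rewrite ?zK ?ler_nat // ltnW.
have zx : z <= x.
  rewrite leNgt; apply/negP => xz.
  have := rbinom_lt (_ : m%:R <= x) xz; rewrite zK ltNge Kx => H; apply/notF/H.
  by apply: le_trans mx; rewrite ler_nat.
split; first exact: le_trans zx.
apply: (@le_trans _ _ #|full (full G r.+1 m.+1) m.+1 m.+2|%:R).
  by rewrite ler_nat subset_leq_card.
apply: le_trans (card_full_next _ _ _) _; last apply: rbinom_le zx.
- by move=> T /fullP[].
- by apply: le_trans mz; rewrite ler_nat.
- by rewrite zK.
- by apply: le_trans mz; rewrite ler_nat.
Qed.

(** * Induced cliques and degrees in complete hypergraphs *)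

(** An isomorphism preserves cardinality, so each [q]-subset of [S] must be an edge. Conversely any
    bijection from [S] to ['I_t] works, since by uniformity the induced edges are exactly the
    [q]-subsets. *)
Lemma cliquesE (q t : nat) (V : finType) (H : {set {set V}}) :
  uniform q H -> cliques q t H = full H q t.
Proof.
move=> Hq; apply/setP => S; rewrite inE; apply/asboolP/fullP.
  case=> f fb fH; have finj := bij_inj fb; split=> [|e eS eq].
    by rewrite -(card_ord t) -(bij_eq_card fb) card_sig; apply: eq_card.
  pose e' := [set u : {x : V | x \in S} | val u \in e].
  have e'E : [set val u | u in e'] = e.
    apply/setP => v; apply/imsetP/idP => [[u + ->]|ve]; first by rewrite inE.
    by exists (Sub v (subsetP eS v ve)); rewrite ?inE.
  have := fH e'; rewrite !inE e'E => <-.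
  by rewrite card_imset // -(card_imset _ val_inj) e'E eq.
case=> St SH; have cS : #|{: {x : V | x \in S}}| = t.
  by rewrite card_sig -St; apply: eq_card.
exists (cast_ord cS \o enum_rank).
  apply: bij_comp; last exact: enum_rank_bij.
  by exists (cast_ord (esym cS));
     [exact: cast_ordK | exact: cast_ordKV].
move=> e; rewrite !inE card_imset; last first.
  by apply: inj_comp; [exact: cast_ord_inj | exact: enum_rank_inj].
rewrite -(card_imset _ val_inj); apply/eqP/idP; last exact: Hq.
by apply: SH; apply/subsetP => _ /imsetP[u _ ->]; exact: valP.
Qed.

(** The link of [I] consists of all [(q - #|I|)]-subsets of the complement of [I]. *)
Lemma degree_complete (V : finType) q (I : {set V}) : (#|I| <= q)%N ->
  degree [set e : {set V} | #|e| == q] I = 'C(#|V| - #|I|, q - #|I|).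
Proof.
move=> Iq; rewrite -card_link.
have -> : (#|V| - #|I|)%N = #|~: I| by rewrite [RHS]cardsCs setCK.
rewrite -cards_draws; apply: eq_card => e; rewrite [in RHS]inE.
apply/imsetP/andP => [[f + ->]|[eI /eqP ek]].
  rewrite !inE => /andP[/eqP fq If].
  by rewrite setDE subsetIr -setDE cardsDS // fq.
have {}eI : [disjoint e & I] by rewrite -[I]setCK -subsets_disjoint.
exists (e :|: I); last by rewrite setUDK.
by rewrite !inE subsetUr cardsU (disjoint_setI0 eI) cards0 subn0 ek subnK ?eqxx.
Qed.

(** * Weights, the parameters of [i]-sets, and the upper bound *)

(** Below [k] the cutoff gives 0, and at [k] the last factor vanishes. *)
Lemma gbinom_neq0 (R : realType) (x : R) k :
  gbinom x k.+1 != 0 -> k%:R < x.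
Proof.
rewrite /gbinom -natr1 addrK; have [_|//|->] := ltgtP x k%:R.
  by rewrite eqxx.
by rewrite -[_ / _]/(rbinom k%:R k.+1) rbinom_nat bin_small ?eqxx.
Qed.

Lemma weightE (R : realType) t i k (y : R) : (t - i)%N = k.+1 ->
  k%:R <= y - i%:R -> weight t i y = (rbinom (y - i%:R) k.+1)^-1.
Proof. by move=> tk ky; rewrite /weight tk gbinomE ?div1r // -natr1 addrK. Qed.

Lemma weight_lt (R : realType) t i k (y z : R) : (t - i)%N = k.+1 ->
  k%:R < y - i%:R -> y < z -> weight t i z < weight t i y.
Proof.
move=> tk ky yz; have yzi : y - i%:R < z - i%:R by rewrite ltrD2r.
have kz := lt_trans ky yzi.
rewrite !(weightE tk) ?(ltW ky) ?(ltW kz) // ltf_pV2 ?posrE.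
- exact: rbinom_lt (ltW ky) yzi.
- by rewrite rbinom_gt0 // -natr1 addrK.
- by rewrite rbinom_gt0 // -natr1 addrK.
Qed.

Section Param.
Variables (R : realType) (q i : nat) (V : finType) (H : {set {set V}}).
Hypothesis iq : (i < q)%N.

Lemma degree_param_exists : exists x : {set V} -> R, degree_param q i H x.
Proof.
have [k qk] : exists k, (q - i)%N = k.+1 by exists (q - i).-1; lia.
have kE : k%:R = q%:R - i%:R - 1 :> R.
  by rewrite -(natrB _ (ltnW iq)) qk -natr1 addrK.
have [I|x hx] := @choice _ _ (fun (I : {set V}) (y : R) =>
    #|I| = i -> q%:R - i%:R - 1 <= y /\
    (degree H I)%:R = gbinom (y - i%:R) (q - i)); last by exists x.
have [z kz zd] := rbinom_surj k (ler0n R (degree H I)).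
exists (z + i%:R) => _; rewrite -kE; split; first by rewrite -[k%:R]addr0 lerD.
by rewrite qk addrK gbinomE // -natr1 addrK.
Qed.

(** The bound makes the degree positive, which excludes the cutoff of [gbinom]; monotonicity of the
    polynomial does the rest. *)
Lemma degree_param_rbinom (x : {set V} -> R) (I : {set V}) n :
  degree_param q i H x -> #|I| = i -> (q - i <= n)%N ->
  ('C(n, q - i) <= degree H I)%N ->
  n%:R <= x I - i%:R /\ (degree H I)%:R = rbinom (x I - i%:R) (q - i).
Proof.
have [k qk] : exists k, (q - i)%N = k.+1 by exists (q - i).-1; lia.
rewrite qk => hx Ii kn hd; have [_] := hx I Ii; rewrite qk => dE.
have kx : k%:R < x I - i%:R.
  by apply: gbinom_neq0; rewrite -dE pnatr_eq0 -lt0n (leq_trans _ hd) ?bin_gt0.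
have dE' : (degree H I)%:R = rbinom (x I - i%:R) k.+1.
  by rewrite dE gbinomE // -natr1 addrK ltW.
split=> //; apply: (rbinom_ge_nat (ltW kx)); first exact: ltnW.
by rewrite -dE' ler_nat.
Qed.

Lemma degree_full t (T I : {set V}) :
  T \in full H q t -> I \subset T -> (#|I| < q)%N ->
  ('C(t - #|I|, q - #|I|) <= degree H I)%N.
Proof.
move=> TK IT /ltnW Iq; rewrite -card_link.
have : (0 < #|full (link H I) (q - #|I|) (t - #|I|)|)%N.
  apply: leq_trans (full_link H t Iq); apply/card_gt0P; exists T.
  by rewrite inE TK.
by case/card_gt0P => S; apply: leq_card_full.
Qed.

Variable t : nat.
Hypothesis qt : (q <= t)%N.

Lemma degree_param_full (x : {set V} -> R) (T I : {set V}) :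
  degree_param q i H x -> T \in full H q t -> I \subset T -> #|I| = i ->
  (t - i)%:R <= x I - i%:R /\ (degree H I)%:R = rbinom (x I - i%:R) (q - i).
Proof.
move=> hx TK IT Ii; apply: degree_param_rbinom => //; first exact: leq_sub2r.
by rewrite -{1 2}Ii; apply: degree_full IT _ => //; rewrite Ii.
Qed.

Lemma le_xmax (x : {set V} -> R) (T I : {set V}) :
  I \subset T -> #|I| = i -> x I <= xmax i x T.
Proof.
by move=> IT Ii; rewrite /xmax; apply: le_bigmax_cond; rewrite IT Ii /=.
Qed.

Lemma xmax_full_ge (x : {set V} -> R) (T : {set V}) :
  degree_param q i H x -> T \in full H q t -> (t - i)%:R <= xmax i x T - i%:R.
Proof.
move=> hx TK; have [I IT Ii] : exists2 I : {set V}, I \subset T & #|I| = i.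
  by apply: exists_subset_card; case/fullP: TK => -> _; lia.
have [h _] := degree_param_full hx TK IT Ii.
by apply: le_trans h _; rewrite lerD2r le_xmax.
Qed.

Lemma sum_weight_link (x : {set V} -> R) (I : {set V}) :
  uniform q H -> degree_param q i H x -> #|I| = i ->
  \sum_(T in full H q t | I \subset T) weight t i (xmax i x T) <= 1.
Proof.
move=> Hq hx Ii.
have [k tk] : exists k, (t - i)%N = k.+1 by exists (t - i).-1; lia.
have [l ql] : exists l, (q - i)%N = l.+1 by exists (q - i).-1; lia.
have Iq : (#|I| <= q)%N by rewrite Ii ltnW.
(* Without a clique through [I] the sum is empty. Otherwise that clique puts [x I - i%:R] at or
   above [t - i], where the weight is positive and decreasing. *)
have [K0|[T]] := set_0Vmem [set T in full H q t | I \subset T].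
  rewrite big1 // => T hT; suff : T \in set0 by rewrite inE.
  by rewrite -K0 inE.
rewrite inE => /andP[TK IT].
have [] := degree_param_full hx TK IT Ii; rewrite tk ql => kx dE.
have kx' : k%:R < x I - i%:R by apply: lt_le_trans kx; rewrite ltr_nat.
have w0 : 0 < rbinom (x I - i%:R) k.+1.
  by rewrite rbinom_gt0 // -natr1 addrK.
apply: (@le_trans _ _ (\sum_(T in full H q t | I \subset T) weight t i (x I))).
  apply: ler_sum => S /andP[SK IS].
  have := le_xmax x IS Ii; rewrite le_eqVlt => /predU1P[->//|/weight_lt h].
  exact/ltW/(h _ _ k).
rewrite (eq_bigl (mem [set S in full H q t | I \subset S])); last first.
  by move=> S; rewrite [RHS]inE.
rewrite sumr_const -mulr_natl (weightE tk (ltW kx')) ler_pdivrMr // mul1r.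
have K0 : full (link H I) l.+1 k.+1 != set0.
  rewrite -card_gt0 -tk -ql -Ii; apply: leq_trans (full_link H t Iq).
  by apply/card_gt0P; exists T; rewrite inE TK.
have Lu : uniform l.+1 (link H I) by rewrite -ql -Ii; apply: uniform_link.
have lk : (l < k.+1)%N by rewrite -tk -ql leq_sub2r.
have lx : l.+1%:R <= x I - i%:R by apply: le_trans kx; rewrite ler_nat.
have Ld : #|link H I|%:R = rbinom (x I - i%:R) l.+1 by rewrite card_link.
have [_] := card_full Lu lx Ld lk K0.
apply: le_trans; rewrite ler_nat -ql -tk -Ii; exact: full_link.
Qed.

Lemma sum_weight (x : {set V} -> R) :
  uniform q H -> degree_param q i H x ->
  \sum_(T in full H q t) weight t i (xmax i x T)
    <= 'C(#|V|, i)%:R / 'C(t, i)%:R.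
Proof.
move=> Hq hx; have Ku : uniform t (full H q t) by move=> T /fullP[].
have ti : 0 < 'C(t, i)%:R :> R by rewrite ltr0n bin_gt0; lia.
rewrite ler_pdivlMr // mulr_natr -(sum_subsets _ _ Ku).
apply: (@le_trans _ _ (\sum_(I : {set V} | #|I| == i) 1)).
  by apply: ler_sum => I /eqP Ii; apply: sum_weight_link.
rewrite sumr_const -card_draws ler_nat subset_leq_card //.
by apply/subsetP => I; rewrite inE.
Qed.

(** Two parameters can disagree only on [i]-sets of degree 0, and no such set lies in a clique;
    elsewhere [rbinom_inj] applies. *)
Lemma xmax_unique (x x' : {set V} -> R) (T : {set V}) :
  degree_param q i H x -> degree_param q i H x' -> T \in full H q t ->
  xmax i x T = xmax i x' T.
Proof.
move=> hx hx' TK; apply: eq_bigr => I /andP[IT /eqP Ii].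
have [l ql] : exists l, (q - i)%N = l.+1 by exists (q - i).-1; lia.
have lt : l%:R <= (t - i)%:R :> R by rewrite ler_nat; lia.
have [kx dx] := degree_param_full hx TK IT Ii.
have [kx' dx'] := degree_param_full hx' TK IT Ii.
apply: (addIr (- i%:R)); apply: (@rbinom_inj _ _ _ l).
- exact: le_trans kx.
- exact: le_trans kx'.
- by rewrite -ql -dx.
Qed.

End Param.

(** * Equality for complete hypergraphs *)

Lemma degree_param_complete (R : realType) (q i : nat) (V : finType) :
  (i < q)%N -> (q <= #|V|)%N ->
  degree_param q i [set e : {set V} | #|e| == q] (fun=> #|V|%:R : R).
Proof.
move=> iq qn I Ii.
have h : q%:R - i%:R - 1 <= #|V|%:R - i%:R :> R.
  have : q%:R <= #|V|%:R :> R by rewrite ler_nat.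
  lra.
split; first by have := ler0n R i; lra.
rewrite gbinomE ?natrB ?(ltnW iq) // -natrB ?(leq_trans (ltnW iq)) //.
by rewrite rbinom_nat degree_complete ?Ii // ltnW.
Qed.

(** Each [i]-set lies in ['C(#|V| - i, t - i)] cliques, each with the reciprocal weight, so it
    contributes exactly 1. *)
Lemma sum_weight_complete (R : realType) (t q i : nat) (V : finType) :
  (q <= t)%N -> (i < q)%N -> (t <= #|V|)%N ->
  \sum_(T in full [set e : {set V} | #|e| == q] q t)
     weight t i (xmax i (fun=> #|V|%:R : R) T) = 'C(#|V|, i)%:R / 'C(t, i)%:R.
Proof.
move=> qt iq tn.
have it : (i < t)%N := leq_trans iq qt.
have [k tk] : exists k, (t - i)%N = k.+1 by exists (t - i).-1; lia.
have -> : full [set e : {set V} | #|e| == q] q t = [set T : {set V} | #|T| == t].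
  apply/setP => T; rewrite [RHS]inE; apply/fullP/eqP => [[]//|Tt].
  by split=> // e _ eq; rewrite inE eq.
have Ku : uniform t [set T : {set V} | #|T| == t] by move=> T; rewrite inE => /eqP.
have ti : 'C(t, i)%:R != 0 :> R by rewrite pnatr_eq0 -lt0n bin_gt0 ltnW.
apply: (canRL (mulfK ti)); rewrite mulr_natr -(sum_subsets _ _ Ku).
rewrite -card_draws -[RHS]sumr_const; apply: eq_big => [I|I /eqP Ii].
  by rewrite inE.
transitivity (\sum_(T in [set T : {set V} | #|T| == t] | I \subset T)
                ('C(#|V| - i, t - i)%:R : R)^-1).
  apply: eq_bigr => T /andP[+ IT]; rewrite inE => /eqP Tt.
  (* The maximum is attained at [I], and the default 0 of [xmax] does not exceed [#|V|]. *)
  have -> : xmax i (fun=> #|V|%:R : R) T = #|V|%:R.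
    apply/eqP; rewrite eq_le (le_xmax (fun=> #|V|%:R : R) IT Ii) andbT.
    by apply: bigmax_le => //; rewrite ler0n.
  have in_ : (i <= #|V|)%N := leq_trans (ltnW it) tn.
  rewrite (weightE tk) -natrB ?rbinom_nat -?tk // ler_nat.
  by apply: ltnW; rewrite -tk leq_sub2r.
rewrite (eq_bigl (mem [set T in [set T : {set V} | #|T| == t] | I \subset T]));
    last by move=> T; rewrite [RHS]inE.
(* The number of [t]-sets containing [I] is a degree in the complete [t]-uniform hypergraph. *)
rewrite sumr_const -/(degree _ _) degree_complete Ii ?(ltnW it) //.
by rewrite -[LHS]mulr_natl divff // pnatr_eq0 -lt0n bin_gt0 leq_sub2r.
Qed.

Theorem theorem5p8 (R : realType) (t q i : nat)
    (hqt : (q <= t)%N) (hiq : (i < q)%N) (hi : (1 <= i)%N) :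
  [/\ (* x and s(T) are well-defined, and the inequality holds *)
      forall (n : nat) (V : finType) (H : {set {set V}}),
        #|V| = n -> uniform q H ->
        [/\ exists x : {set V} -> R, degree_param q i H x,
            forall x x' : {set V} -> R,
              degree_param q i H x -> degree_param q i H x' ->
              forall T, T \in cliques q t H -> xmax i x T = xmax i x' T,
            forall x : {set V} -> R, degree_param q i H x ->
              forall T, T \in cliques q t H ->
                gbinom (xmax i x T - i%:R) (t - i) != 0
          & forall x : {set V} -> R, degree_param q i H x ->
              \sum_(T in cliques q t H) weight t i (xmax i x T)
                <= 'C(n, i)%:R / 'C(t, i)%:R],
      (* s is strictly decreasing wherever its denominator is nonzero *)
      forall y z : R,
        gbinom (y - i%:R) (t - i) != 0 -> gbinom (z - i%:R) (t - i) != 0 ->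
        y < z -> weight t i z < weight t i y
    & (* equality holds for hypergraphs with arbitrarily many vertices *)
      forall N : nat, exists (n : nat) (H : {set {set 'I_n}}),
        [/\ (N <= n)%N, uniform q H
          & exists2 x : {set 'I_n} -> R, degree_param q i H x &
              \sum_(T in cliques q t H) weight t i (xmax i x T)
                = 'C(n, i)%:R / 'C(t, i)%:R]].

Proof.
have [k tk] : exists k, (t - i)%N = k.+1 by exists (t - i).-1; lia.
split.
- move=> n V H <- Hq; rewrite cliquesE //; split.
  + exact: degree_param_exists.
  + by move=> x x' hx hx' T; apply: xmax_unique hx hx'.
  + move=> x hx T TK; have := xmax_full_ge hiq hqt hx TK.
    rewrite tk => kx; rewrite gbinomE; last first.
      by rewrite -natr1 addrK (le_trans _ kx) ?ler_nat.
    by rewrite lt0r_neq0 // rbinom_gt0 // -natr1 addrK (lt_le_trans _ kx) ?ltr_nat.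
  + by move=> x hx; apply: sum_weight.
- move=> y z; rewrite tk => /gbinom_neq0 ky _; exact: weight_lt tk ky.
(* Adding [t] guarantees at least [t] vertices, as [sum_weight_complete] requires. *)
- move=> N; exists (N + t)%N, [set e : {set 'I_(N + t)} | #|e| == q].
  have Hq : uniform q [set e : {set 'I_(N + t)} | #|e| == q].
    by move=> e; rewrite inE => /eqP.
  split=> //; first exact: leq_addr.
  have cV : #|'I_(N + t)| = (N + t)%N := card_ord _.
  exists (fun=> #|'I_(N + t)|%:R).
    by apply: degree_param_complete; rewrite ?cV; lia.
  rewrite cliquesE // sum_weight_complete ?cV //; lia.
Qed.
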